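(* Let $(L,* )$ be an LD-system, let $s_1,\ldots,s_m,t_1,\ldots,t_n\in L$, and let $S_A=\langle s_1,\ldots,s_m\rangle_*$ and $S_B=\langle t_1,\ldots,t_n\rangle_*$ be the submagmas of $(L,* )$ they generate. Let $k_A,k_B\ge 1$, let $a_0\in S_A$, $a_1,\ldots,a_{k_A}\in L$ and $b_1,\ldots,b_{k_B}\in S_B$, and put $$\alpha(y)=a_{k_A}*(a_{k_A-1}*\cdots*(a_2*(a_1*y))\cdots),\qquad \beta(y)=b_{k_B}*(b_{k_B-1}*\cdots*(b_2*(b_1*y))\cdots)$$ for $y\in L$, and $p_0=\alpha(a_0)$. Suppose $a_0=T_*(r_1,\ldots,r_l)$ with all $r_i\in\{s_1,\ldots,s_m\}$ and, for each $1\le j\le k_B$, $b_j=T^{(j)}_*(u_{j,1},\ldots,u_{j,l_j})$ with all $u_{j,i}\in\{t_1,\ldots,t_n\}$. Then $$T_*(\beta(r_1),\ldots,\beta(r_l))=\beta(a_0),\qquad T^{(j)}_*(\alpha(u_{j,1}),\ldots,\alpha(u_{j,l_j}))=\alpha(b_j)\quad(1\le j\le k_B),$$ and the key $K_A:=\alpha(\beta(a_0))$ computed by Alice equals the key computed by Bob, $$K_B:=\alpha(b_{k_B})*(\alpha(b_{k_B-1})*(\cdots(\alpha(b_2)*(\alpha(b_1)*p_0))\cdots)).$$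
   Context: An LD-system (left self-distributive system) is a set $L$ with a binary operation $*$ such that $x*(y*z)=(x*y)*(x*z)$ for all $x,y,z\in L$. A magma is a set with a binary operation (not necessarily associative). For a planar rooted binary tree $T$ with $k$ leaves and elements $y_1,\ldots,y_k$ of a magma $(M,* )$, $T_*(y_1,\ldots,y_k)$ denotes the iterated product obtained by labelling the leaves of $T$ from left to right by $y_1,\ldots,y_k$ and evaluating each internal vertex with the operation $*$. The submagma $\langle y_1,\ldots,y_k\rangle_*$ consists of all such iterated products with leaves in $\{y_1,\ldots,y_k\}$. *)

(* Defs.v *)
From mathcomp Require Import all_boot.

Set Implicit Arguments.
Unset Strict Implicit.
Unset Printing Implicit Defensive.

(* An LD-system is a type [L] with [op : L -> L -> L] satisfying this axiom.
   It is [right_distributive op op] in the naming convention of ssrfun. *)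
Definition left_self_distributive (L : Type) (op : L -> L -> L) : Prop :=
  forall x y z : L, op x (op y z) = op (op x y) (op x z).

(* Planar rooted binary trees, indexed by their number of leaves. *)
Inductive bintree : nat -> Type :=
| Leaf : bintree 1
| Node m n : bintree m -> bintree n -> bintree (m + n).

(* T_*(y_0, ..., y_(k-1)): the first [m] leaves of [Node T1 T2], from left to
   right, are those of [T1], the last [n] those of [T2]. *)
Fixpoint tree_prod (L : Type) (op : L -> L -> L) (k : nat) (T : bintree k) :
    ('I_k -> L) -> L :=
  match T in bintree k return ('I_k -> L) -> L with
  | Leaf => fun y => y ord0
  | @Node m n T1 T2 => fun y =>
      op (tree_prod op T1 (fun i => y (lshift n i)))
         (tree_prod op T2 (fun i => y (rshift m i)))
  end.

Definition in_family (L : Type) (k : nat) (y : 'I_k -> L) (x : L) : Prop :=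
  exists i : 'I_k, x = y i.

Definition submagma (L : Type) (op : L -> L -> L) (k : nat) (y : 'I_k -> L)
    (x : L) : Prop :=
  exists (l : nat) (T : bintree l) (r : 'I_l -> L),
    (forall i, in_family y (r i)) /\ x = tree_prod op T r.

(* c_k * (c_(k-1) * ... * (c_2 * (c_1 * y))): indices start at 0 here, and
   [enum 'I_k] is increasing, so [c ord0] acts first. *)
Definition iter_lmul (L : Type) (op : L -> L -> L) (k : nat) (c : 'I_k -> L)
    (y : L) : L :=
  foldl (fun z i => op (c i) z) y (enum 'I_k).

(* Main.v *)
Require Import Defs.
From mathcomp Require Import all_boot.

Set Implicit Arguments.
Unset Strict Implicit.
Unset Printing Implicit Defensive.

(** Left self-distributivity says that every left multiplication is an
    endomorphism of the magma [L], hence so are [alpha] and [beta].  All three claims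
    follow by pushing these endomorphisms through iterated products. *)

Lemma tree_prod_morph (L : Type) (op : L -> L -> L) (f : L -> L) :
  {morph f : x y / op x y} -> forall k (T : bintree k) (y : 'I_k -> L),
  f (tree_prod op T y) = tree_prod op T (fun i => f (y i)).
Proof.
by move=> fM k; elim=> [|m n T1 IH1 T2 IH2] y //=; rewrite fM IH1 IH2.
Qed.

(** An endomorphism [f] passes each left multiplication by [c i], turning it into left
    multiplication by [f (c i)]. This is what lets Bob compute the key from the images of his
    factors. *)
Lemma iter_lmul_morph_image (L : Type) (op : L -> L -> L) (f : L -> L) :
  {morph f : x y / op x y} -> forall k (c : 'I_k -> L) (y : L),
  f (iter_lmul op c y) = iter_lmul op (fun i => f (c i)) (f y).
Proof.
rewrite /iter_lmul => fM k c y.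
(* [y] stays general because [foldl] updates its accumulator at every step. *)
by elim: (enum 'I_k) y => //= i e IH y; rewrite IH fM.
Qed.

(** A composite of endomorphisms is an endomorphism. *)
Lemma iter_lmul_morph (L : Type) (op : L -> L -> L) (k : nat) (c : 'I_k -> L) :
  left_self_distributive op -> {morph iter_lmul op c : x y / op x y}.
Proof.
rewrite /iter_lmul => op_LD x y.
by elim: (enum 'I_k) x y => //= i e IH x y; rewrite op_LD IH.
Qed.

Theorem mainTheorem1
  (L : Type) (op : L -> L -> L) (op_LD : left_self_distributive op)
  (m n : nat) (s : 'I_m -> L) (t : 'I_n -> L)
  (kA kB : nat) (kA_ge1 : 1 <= kA) (kB_ge1 : 1 <= kB)
  (a0 : L) (a0_SA : submagma op s a0)
  (a : 'I_kA -> L)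
  (b : 'I_kB -> L) (b_SB : forall j, submagma op t (b j))
  (l : nat) (T : bintree l) (r : 'I_l -> L)
  (r_s : forall i, in_family s (r i))
  (a0_T : a0 = tree_prod op T r)
  (lB : 'I_kB -> nat) (TB : forall j, bintree (lB j))
  (u : forall j, 'I_(lB j) -> L)
  (u_t : forall j i, in_family t (u j i))
  (b_TB : forall j, b j = tree_prod op (TB j) (u j)) :
  let alpha := iter_lmul op a in
  let beta := iter_lmul op b in
  let p0 := alpha a0 in
  let KA := alpha (beta a0) in
  let KB := iter_lmul op (fun j => alpha (b j)) p0 in
  [/\ tree_prod op T (fun i => beta (r i)) = beta a0,
      forall j, tree_prod op (TB j) (fun i => alpha (u j i)) = alpha (b j)
    & KA = KB].
Proof.
move=> alpha beta p0 KA KB.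
have alphaM : {morph alpha : x y / op x y} by exact: iter_lmul_morph.
have betaM : {morph beta : x y / op x y} by exact: iter_lmul_morph.
split=> [|j|].
- by rewrite a0_T (tree_prod_morph betaM).
- by rewrite b_TB (tree_prod_morph alphaM).
(* Here [alpha] is pushed through [beta], whose innermost argument [a0] becomes [p0]. *)
- exact: (iter_lmul_morph_image alphaM).
Qed.
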